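(* Let $a,b,c\ge1$ be integers. Then $J(\mathbf a\times\mathbf b\times\mathbf c)$ under $\mathrm{Row}$ is in equivariant bijection with $\mathrm{Inc}^{a+b+c-1}(a\times b)$ under $K\text{-}\mathrm{Pro}$; that is, there is a bijection $\varphi:J(\mathbf a\times\mathbf b\times\mathbf c)\to\mathrm{Inc}^{a+b+c-1}(a\times b)$ with $\varphi\circ\mathrm{Row}=K\text{-}\mathrm{Pro}\circ\varphi$.
   Context: **Plane partitions and rowmotion.** $\mathbf a\times\mathbf b\times\mathbf c$ is the set of integer triples $(x_1,x_2,x_3)$ with $0\le x_1\le a-1$, $0\le x_2\le b-1$, $0\le x_3\le c-1$, ordered componentwise; $J(\mathbf a\times\mathbf b\times\mathbf c)$ is its set of order ideals (downward closed subsets), i.e. plane partitions in an $a\times b\times c$ box. Rowmotion $\mathrm{Row}:J(P)\to J(P)$ sends $I$ to the order ideal whose maximal elements are exactly the minimal elements of $P\setminus I$. **Increasing tableaux.** An increasing tableau of shape $a\times b$ is a filling of the rectangle with $a$ rows and $b$ columns by positive integers that strictly increase from left to right along rows and from top to bottom down columns. $\mathrm{Inc}^q(a\times b)$ is the set of those with all entries at most $q$ (not every integer in $\{1,\dots,q\}$ need appear). **$K$-promotion.** For $T\in\mathrm{Inc}^q(a\times b)$, delete all labels $1$. Then for $i=2,3,\dots,q$ in turn, consider the set of boxes that are currently empty or contain $i$, and decompose it into connected components (adjacency = sharing an edge). In each component with more than one box, simultaneously delete every label $i$ and place $i$ in every box that was empty; leave one-box components unchanged. Finally, fill the remaining empty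 boxes with $q+1$ and subtract $1$ from every entry. The result is $K\text{-}\mathrm{Pro}(T)\in\mathrm{Inc}^q(a\times b)$. *)

(* Defs.v *)
From mathcomp Require Import all_boot all_order.
From mathcomp Require Import zify.

Set Implicit Arguments.
Unset Strict Implicit.
Unset Printing Implicit Defensive.

Import Order.TTheory.

Section Rowmotion.
Context {d : Order.disp_t} {P : finPOrderType d}.
Implicit Types I J : {set P}.

Definition order_ideal I : bool :=
  [forall x in I, forall y, (y <= x)%O ==> (y \in I)].

Definition minelts I : {set P} :=
  [set x in I | [forall y in I, ~~ (y < x)%O]].

Definition maxelts I : {set P} :=
  [set x in I | [forall y in I, ~~ (x < y)%O]].

(* The order ideal generated by the minimal elements of the complement;
   [row_setP] shows that it is the only order ideal whose maximal elements are
   the minimal elements of the complement. *)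
Definition row_set I : {set P} :=
  [set x | [exists y in minelts (~: I), (x <= y)%O]].

Lemma order_idealP I :
  reflect (forall x y, x \in I -> (y <= x)%O -> y \in I) (order_ideal I).
Proof.
apply: (iffP forall_inP) => [h x y /h /forallP /(_ y) /implyP //|h x xI].
by apply/forallP => y; apply/implyP; apply: h xI.
Qed.

Lemma row_set_ideal I : order_ideal (row_set I).
Proof.
apply/order_idealP => x y; rewrite !inE => /existsP[z /andP[zm xz]] yx.
by apply/existsP; exists z; rewrite zm (le_trans yx xz).
Qed.

Lemma maxelts_above J x : x \in J -> exists2 y, y \in maxelts J & (x <= y)%O.
Proof.
have [n] := ubnP #|[set y in J | (x < y)%O]|.
elim: n x => // n IHn x ltn xJ.
have [xm|] := boolP (x \in maxelts J); first by exists x.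
rewrite inE xJ /= => /forall_inPn[y yJ /negPn xy].
have [|//|z zm yz] := IHn y; last by exists z => //; apply/ltW/(lt_le_trans xy).
apply: leq_trans (ltn : (_ <= n)%N); apply: proper_card; apply/properP; split.
  by apply/subsetP => z; rewrite !inE => /andP[-> /(lt_trans xy)].
by exists y; rewrite !inE yJ ?xy // ltxx.
Qed.

Lemma row_setP I J :
  order_ideal J -> (maxelts J == minelts (~: I)) = (J == row_set I).
Proof.
move=> /order_idealP Jid; apply/eqP/eqP => [eqm|->].
  apply/setP => x; rewrite inE -eqm; apply/idP/exists_inP.
    by move=> /maxelts_above[y ym xy]; exists y.
  by move=> [y]; rewrite inE => /andP[yJ _]; apply: Jid.
apply/setP => x; apply/idP/idP => [|xm].
  rewrite inE => /andP[]; rewrite inE => /exists_inP[y ym xy] /forall_inP xmax.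
  have yrow : y \in row_set I by rewrite inE; apply/exists_inP; exists y.
  by move: (xmax y yrow); rewrite lt_neqAle xy andbT negbK => /eqP ->.
rewrite inE; apply/andP; split.
  by rewrite inE; apply/exists_inP; exists x.
apply/forall_inP => y; rewrite inE => /exists_inP[z zm yz].
apply/negP => /lt_le_trans /(_ yz) xz.
move: xm zm; rewrite !inE => /andP[xI _] /andP[_ /forall_inP /(_ x)].
by rewrite inE xI xz => /(_ isT).
Qed.

End Rowmotion.

Definition ideals {d : Order.disp_t} (P : finPOrderType d) : Type :=
  {I : {set P} | order_ideal I}.

Definition Row {d : Order.disp_t} {P : finPOrderType d} (I : ideals P) :
    ideals P :=
  exist _ (row_set (val I)) (row_set_ideal (val I)).

Section KPromotion.
Variables a b : nat.

(* [(i, j)] is the box in row [i] and column [j]. *)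
Notation box := ('I_a * 'I_b)%type.
Implicit Types (T : {ffun box -> nat}) (S : {ffun box -> option nat}).

Definition increasing_tableau (q : nat) T : bool :=
  [&& [forall x, 0 < T x <= q],
      [forall i, forall j : 'I_b, forall j' : 'I_b,
         (j < j') ==> (T (i, j) < T (i, j'))]
    & [forall j, forall i : 'I_a, forall i' : 'I_a,
         (i < i') ==> (T (i, j) < T (i', j))]].

Definition Inc (q : nat) : Type :=
  {T : {ffun box -> nat} | increasing_tableau q T}.

Definition next_box : rel box := fun x y =>
  ((x.1 == y.1) && (x.2.+1 == y.2 :> nat)) ||
  ((x.2 == y.2) && (x.1.+1 == y.1 :> nat)).

Definition adjacent : rel box := fun x y => next_box x y || next_box y x.

(* During promotion a box contains [Some v], or [None] when it is empty. *)
Definition active (i : nat) S (x : box) : bool :=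
  (S x == None) || (S x == Some i).

Definition active_adjacent (i : nat) S : rel box := fun x y =>
  [&& active i S x, active i S y & adjacent x y].

Definition component (i : nat) S (x : box) : {set box} :=
  [set y | connect (active_adjacent i S) x y].

Definition delete_ones T : {ffun box -> option nat} :=
  [ffun x => if T x == 1 then None else Some (T x)].

Definition swap_step S (i : nat) : {ffun box -> option nat} :=
  [ffun x => if active i S x && (1 < #|component i S x|)
             then (if S x is None then Some i else None)
             else S x].

Definition fill_and_decrement (q : nat) S : {ffun box -> nat} :=
  [ffun x => (odflt q.+1 (S x)).-1].

Definition kpro_fun (q : nat) T : {ffun box -> nat} :=
  fill_and_decrement q (foldl swap_step (delete_ones T) (iota 2 q.-1)).

(* Once the labels up to [i] are processed, the entries increase strictly
   provided that empty boxes count as larger than [i] and smaller than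
   [i + 1]. *)
Let key (i : nat) (o : option nat) : nat :=
  if o is Some v then v.*2 else i.*2.+1.

Let inv (q i : nat) S : Prop :=
  (forall x v, S x = Some v -> 2 <= v <= q) /\
  (forall x y, next_box x y -> key i (S x) < key i (S y)).

Lemma increasing_tableauP q T :
  reflect ((forall x, 0 < T x <= q) /\
           (forall x y, next_box x y -> T x < T y))
          (increasing_tableau q T).
Proof.
apply: (iffP and3P) => -[].
  move=> /forallP Tq /forallP Trow /forallP Tcol; split=> // -[i j] [i' j'].
  case/orP => /= /andP[/eqP <- /eqP e].
    by move/forallP: (Trow i) => /(_ j) /forallP /(_ j'); rewrite -e ltnSn.
  by move/forallP: (Tcol j) => /(_ i) /forallP /(_ i'); rewrite -e ltnSn.
move=> Tq Tnext; split; first exact/forallP.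
  apply/forallP => i; apply/forallP => j; apply/forallP => -[n nb].
  apply/implyP => /=; elim: n nb => // n IHn nb; rewrite ltnS => jn.
  have nb' : n < b by apply: ltnW.
  have lt : T (i, Ordinal nb') < T (i, Ordinal nb).
    by apply: Tnext; rewrite /next_box /= !eqxx.
  move: jn; rewrite leq_eqVlt => /orP[/eqP e|/(IHn nb')/ltn_trans]; last exact.
  by have -> : j = Ordinal nb' by apply: val_inj.
apply/forallP => j; apply/forallP => i; apply/forallP => -[n na].
apply/implyP => /=; elim: n na => // n IHn na; rewrite ltnS => jn.
have na' : n < a by apply: ltnW.
have lt : T (Ordinal na', j) < T (Ordinal na, j).
  by apply: Tnext; rewrite /next_box /= !eqxx orbT.
move: jn; rewrite leq_eqVlt => /orP[/eqP e|/(IHn na')/ltn_trans]; last exact.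
by have -> : i = Ordinal na' by apply: val_inj.
Qed.

Lemma component_gt1 i S x y :
  active i S x -> active i S y -> adjacent x y -> 1 < #|component i S x|.
Proof.
move=> ax ay xy; have ne : x != y.
  by apply/eqP => e; move: xy; rewrite e /adjacent /next_box !eqxx /=; lia.
have <- : #|[set x; y]| = 2 by rewrite cards2 ne.
apply/subset_leq_card/subsetP => z; rewrite !inE => /orP[]/eqP-> //.
by apply: connect1; rewrite /active_adjacent ax ay.
Qed.

Lemma inv_delete_ones q T : increasing_tableau q T -> inv q 1 (delete_ones T).
Proof.
move=> /increasing_tableauP[Tq Tnext]; split=> [x v|x y /Tnext].
  by rewrite ffunE; case: eqP => // ne [<-]; move: (Tq x); lia.
by rewrite !ffunE; move: (Tq x) (Tq y); do 2?[case: eqP] => /=; lia.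
Qed.

Lemma inv_swap_step q i S :
  0 < i < q -> inv q i S -> inv q i.+1 (swap_step S i.+1).
Proof.
move=> iq [Sq Snext]; split=> [x v|x y xy].
  rewrite ffunE; case: ifP => _; last exact: Sq.
  by case: (S x) => // -[<-]; lia.
have := Snext x y xy; rewrite !ffunE.
have gtx (ax : active i.+1 S x) (ay : active i.+1 S y) : 1 < #|component i.+1 S x|.
  by apply: (component_gt1 ax ay); rewrite /adjacent xy.
have gty (ax : active i.+1 S x) (ay : active i.+1 S y) : 1 < #|component i.+1 S y|.
  by apply: (component_gt1 ay ax); rewrite /adjacent xy orbT.
case: (boolP (active i.+1 S x)) gtx gty => Ax;
  case: (boolP (active i.+1 S y)) => Ay gtx gty.
- rewrite gtx // gty //=; move: Ax Ay.
  by case/orP=> /eqP-> /orP[]/eqP-> /=; lia.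
- move: Ay; rewrite negb_or /=; case Ey: (S y) => [v|] //= /eqP vi.
  have {}vi : v <> i.+1 by move=> e; apply: vi; rewrite e.
  by case: (1 < _); case/orP: Ax => /eqP-> /=; lia.
- move: Ax; rewrite negb_or /=; case Ex: (S x) => [v|] //= /eqP vi.
  have {}vi : v <> i.+1 by move=> e; apply: vi; rewrite e.
  by case: (1 < _); case/orP: Ay => /eqP-> /=; lia.
- by move: Ax Ay; rewrite !negb_or; case: (S x) => [u|]; case: (S y).
Qed.

Lemma kpro_fun_increasing q T :
  increasing_tableau q T -> increasing_tableau q (kpro_fun q T).
Proof.
move=> incT; case: q incT => [|q] incT.
  case/increasing_tableauP: incT => Tq Tnext.
  by apply/increasing_tableauP; split=> [x|x y _]; move: (Tq x); lia.
have [] : inv q.+1 q.+1 (foldl swap_step (delete_ones T) (iota 2 q)).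
  suff H n : n <= q ->
      inv q.+1 n.+1 (foldl swap_step (delete_ones T) (iota 2 n)) by exact: H.
  elim: n => [_|n IHn nq]; first exact: inv_delete_ones.
  have -> : iota 2 n.+1 = iota 2 n ++ [:: n.+2].
    by rewrite -(addn1 n) iotaD add2n addn1.
  rewrite foldl_cat /=; apply: inv_swap_step; first lia.
  by apply: IHn; lia.
rewrite /kpro_fun /=; set S := foldl _ _ _ => Sq Snext.
apply/increasing_tableauP; split=> [x|x y /Snext]; rewrite !ffunE.
  by case E: (S x) => [v|] /=; [move: (Sq _ _ E); lia | lia].
case Ex: (S x) => [u|]; case Ey: (S y) => [v|] /=; try lia.
- by move: (Sq _ _ Ex) (Sq _ _ Ey); lia.
- by move: (Sq _ _ Ey); lia.
Qed.

Definition KPro (q : nat) (T : Inc q) : Inc q :=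
  exist _ (kpro_fun q (val T)) (kpro_fun_increasing (valP T)).

End KPromotion.

(* Main.v *)
Require Import Defs.
From mathcomp Require Import all_boot all_order.
From mathcomp Require Import zify.

Set Implicit Arguments.
Unset Strict Implicit.
Unset Printing Implicit Defensive.

Import Order.TTheory.

(** An order ideal of the product of three chains is a pile of height
    [height I x] over each box [x], and [entry I x = rank x + c.+1 - height I x]
    identifies ideals with increasing tableaux ([tableau_bij]).  In these terms
    both dynamics are governed by the same local rule ([local_rule]): lower a
    label by one if this keeps it above its predecessors, and otherwise replace it
    by the least label that follows it, minus one.  They differ only in which of
    the neighbours have already been updated.  Writing [U] for the image of [T],

    - K-promotion sweeps from small to large rank: [U x] depends on [T x], on [U]
      before [x] and on [T] after [x] ([kpro_fun_local]);
    - rowmotion sweeps from large to small rank: [U x] depends on [T x], on [T]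
      before [x] and on [U] after [x] ([entry_row_local]).

    Consider the whole orbit of an ideal [I] under rowmotion as a function of the
    box [x] and of the time [t].  The value at [x] and time [t.+1] depends on the
    values before [x] at time [t] and on those after [x] at time [t.+1].  Counting
    time from [rank x] at each box [x], the values before [x] are then one step
    ahead, thus already updated, and those after [x] are not: the second rule has
    become the first.
    Hence the map sending [I] to the filling [x |-> entry (Row^(rank x) I) x]
    carries rowmotion to K-promotion ([sheared_tableau_Row]).  The filling
    increases because a pile can never be raised beyond the old piles before it
    ([height_row_le]).

    For bijectivity, equivariance recovers from the shear the orbit of [I] at all
    times [t >= rank x], in particular the ideal at time [a + b], and hence [I]
    because rowmotion is injective; a count finishes the argument.

    The rule for K-promotion is obtained from a closed form of each intermediate
    filling ([promotion_stage]) in terms of the set of boxes through which the empty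
    space travels ([vacated]). *)

(** * A local rule on the boxes of a rectangle *)

Section LocalRule.
Variables a b : nat.
Notation box := ('I_a * 'I_b)%type.
Implicit Types (x y : box) (A B C T : box -> nat).

Definition rank x : nat := x.1 + x.2.

Lemma next_box_rank x y : next_box x y -> rank y = (rank x).+1.
Proof. by rewrite /next_box /rank => /orP[] /andP[/eqP -> /eqP]; lia. Qed.

Lemma next_box_neq x y : next_box x y -> x != y.
Proof. by move=> /next_box_rank e; apply/eqP => xy; move: e; rewrite xy; lia. Qed.

Lemma next_box_towards x y :
  x.1 <= y.1 -> x.2 <= y.2 -> x != y ->
  exists2 x', next_box x x' & (x'.1 <= y.1) && (x'.2 <= y.2).
Proof.
case: x y => [i j] [i' j'] /= le1 le2 ne.
have [lt1|ge1] := ltnP i i'.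
  exists (Ordinal (leq_ltn_trans lt1 (ltn_ord i')), j); last by rewrite /= lt1 le2.
  by rewrite /next_box /= !eqxx orbT.
have ei : i = i' by apply: val_inj => /=; lia.
have lt2 : j < j'.
  rewrite ltn_neqAle le2 andbT; apply: contraNneq ne => e.
  by rewrite ei (val_inj e).
exists (i, Ordinal (leq_ltn_trans lt2 (ltn_ord j'))); last by rewrite /= le1 lt2.
by rewrite /next_box /= !eqxx.
Qed.

Lemma next_box_back x y :
  x.1 <= y.1 -> x.2 <= y.2 -> x != y ->
  exists2 y', next_box y' y & (x.1 <= y'.1) && (x.2 <= y'.2).
Proof.
case: x y => [i j] [i' j'] /= le1 le2 ne.
have [lt1|ge1] := ltnP i i'.
  exists (Ordinal (leq_ltn_trans (leq_pred i') (ltn_ord i')), j').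
    by rewrite /next_box /= eqxx (ltn_predK lt1) eqxx orbT.
  by rewrite /= le2 andbT; lia.
have ei : i = i' by apply: val_inj => /=; lia.
have lt2 : j < j'.
  rewrite ltn_neqAle le2 andbT; apply: contraNneq ne => e.
  by rewrite ei (val_inj e).
exists (i', Ordinal (leq_ltn_trans (leq_pred j') (ltn_ord j'))).
  by rewrite /next_box /= eqxx (ltn_predK lt2) eqxx.
by rewrite /= ei leqnn /=; lia.
Qed.

(** The default [q.+1] makes the last box behave as if it had a successor
    labelled just above the allowed range, which is the label that K-promotion
    puts into the boxes left empty. *)
Definition min_next (q : nat) C x : nat :=
  \big[minn/q.+1]_(y | next_box x y) C y.

Lemma min_next_leq q C x i :
  (min_next q C x <= i) = (q < i) || [exists y, next_box x y && (C y <= i)].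
Proof.
have -> : [exists y, next_box x y && (C y <= i)] =
          has (fun y => next_box x y && (C y <= i)) (index_enum box).
  apply/existsP/hasP => [[y h]|[y _ h]]; exists y => //.
  exact: mem_index_enum.
rewrite /min_next; elim: (index_enum _) => [|y r IHr].
  by rewrite big_nil orbF.
rewrite big_cons /=; case: (next_box x y) => //=.
by rewrite geq_min IHr orbCA.
Qed.

Lemma min_next_le q C x y : next_box x y -> min_next q C x <= C y.
Proof.
move=> xy; rewrite min_next_leq; apply/orP; right.
by apply/existsP; exists y; rewrite xy /=.
Qed.

Lemma min_next_gt q C x n :
  n <= q -> (forall y, next_box x y -> n < C y) -> n < min_next q C x.
Proof.
move=> nq lt; rewrite ltnNge min_next_leq negb_or -leqNgt nq /=.
by apply/existsP => -[y /andP[/lt]]; lia.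
Qed.

Lemma eq_min_next q C C' x :
  (forall y, next_box x y -> C y = C' y) -> min_next q C x = min_next q C' x.
Proof. exact: eq_bigr. Qed.

(** A label is lowered by one if it then still exceeds the entries [A] before it;
    otherwise it jumps to just below the entries [C] after it.  Seen in the box
    alone this is a cyclic rotation through the labels that its neighbours allow.
    Keeping the three fillings [A], [B], [C] apart is what lets one formula
    describe sweeps in either direction: a filling that is already updated on one
    side of the box is used on that side. *)
Definition local_rule (q : nat) A B C x : nat :=
  if (1 < B x) && [forall y, next_box y x ==> ((A y).+1 < B x)]
  then (B x).-1 else (min_next q C x).-1.

Lemma eq_local_rule q A A' B B' C C' x :
  (forall y, next_box y x -> A y = A' y) -> B x = B' x ->
  (forall y, next_box x y -> C y = C' y) ->
  local_rule q A B C x = local_rule q A' B' C' x.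
Proof.
move=> eA eB /(@eq_min_next q) eC; rewrite /local_rule eB eC.
congr (if _ && _ then _ else _); apply: eq_forallb => y.
by apply: implyb_id2l => /eA ->.
Qed.

(** When the boxes before [x] use the new filling and those after [x] use the old
    one, the rule is a recursion on the rank of the box. *)
Lemma local_rule_unique q (T : box -> nat) (U V : box -> nat) :
  (forall x, U x = local_rule q U T T x) ->
  (forall x, V x = local_rule q V T T x) -> U =1 V.
Proof.
move=> eU eV x; have [n] := ubnP (rank x); elim: n x => // n IHn x lt.
rewrite eU eV; apply: eq_local_rule => // y /next_box_rank e.
by apply: IHn; lia.
Qed.

End LocalRule.

(** * K-promotion obeys the local rule *)

Section Promotion.
Variables (a b q : nat).
Notation box := ('I_a * 'I_b)%type.
Implicit Types (x y : box) (T : {ffun box -> nat}).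

(** Promotion only asks whether a component is a single box, so its components
    never have to be described: looking at the neighbours of a box is enough. *)
Lemma card_component_gt1 i (S : {ffun box -> option nat}) x :
  active i S x ->
  (1 < #|component i S x|) = [exists y, adjacent x y && active i S y].
Proof.
move=> ax; apply/idP/existsP => [|[y /andP[xy ay]]]; last first.
  exact: component_gt1 xy.
rewrite (cardsD1 x) inE connect0 ltnS card_gt0 => /set0Pn[z].
rewrite !inE => /andP[zx /connectP[[|y p] /= pth ez]].
  by rewrite ez eqxx in zx.
by case/andP: pth => /and3P[_ ay xy] _; exists y; rewrite xy ay.
Qed.

(** The boxes that promotion empties at some stage: the empty space starts at the
    labels [1], and a box that is empty is filled from those of its successors that
    carry the least label, which are emptied in turn. *)
Definition vacated T x : bool :=
  [exists y, (T y == 1) &&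
     connect (fun y z => next_box y z && (min_next q T y == T z)) y x].

Lemma vacatedE T x :
  vacated T x = (T x == 1) ||
    [exists y, [&& next_box y x, vacated T y & min_next q T y == T x]].
Proof.
apply/idP/orP => [/existsP[y /andP[y1 /connectP[p]]]|].
  case/lastP: p => [|p z]; first by move=> _ ->; left.
  rewrite last_rcons rcons_path => /andP[pth lst] ->; right.
  case/andP: lst => nx mn.
  apply/existsP; exists (last y p); rewrite nx mn andbT /=.
  by apply/existsP; exists y; rewrite y1; apply/connectP; exists p.
case=> [x1|/existsP[y /and3P[yx /existsP[z /andP[z1 zy]] mn]]].
  by apply/existsP; exists x; rewrite x1 connect0.
apply/existsP; exists z; rewrite z1 /=.
by apply: connect_trans zy _; apply: connect1; rewrite yx.
Qed.

(** Closed form of the filling once the labels up to [i] are processed: a vacated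
    box is emptied when its own label comes up, and filled again with the least
    label after it when that label comes up. *)
Definition promotion_stage T i : {ffun box -> option nat} :=
  [ffun x => if vacated T x && (T x <= i)
             then (if min_next q T x <= i then Some (min_next q T x) else None)
             else Some (T x)].

Section Increasing.
Variable T : {ffun box -> nat}.
Hypothesis incT : increasing_tableau q T.

Let Tq x : 0 < T x <= q.
Proof. by case/increasing_tableauP: incT => ->. Qed.

Let Tnext x y : next_box x y -> T x < T y.
Proof. by case/increasing_tableauP: incT => _; apply. Qed.

Let Tmin x : T x < min_next q T x.
Proof. by apply: min_next_gt => [|y /Tnext //]; case/andP: (Tq x). Qed.

Lemma promotion_stage1 : delete_ones T = promotion_stage T 1.
Proof.
apply/ffunP => x; rewrite !ffunE.
have := Tmin x; have := Tq x.
case: eqP => [e1|ne1 Tx _].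
  by rewrite vacatedE e1 eqxx /= => _; case: leqP => //; lia.
by case: ifP => // /andP[_]; lia.
Qed.

(** Two adjacent active boxes must be an empty box followed by a box labelled
    [i.+1].  Hence an empty box has an active neighbour exactly when [i.+1] is the
    least label after it, and a box labelled [i.+1] has one exactly when it is
    vacated. *)
Lemma swap_stage i : 0 < i < q ->
  swap_step (promotion_stage T i) i.+1 = promotion_stage T i.+1.
Proof.
move=> iq; apply/ffunP => x; rewrite ffunE.
have stE y : promotion_stage T i y =
    if vacated T y && (T y <= i)
    then (if min_next q T y <= i then Some (min_next q T y) else None)
    else Some (T y) by rewrite ffunE.
have emptyE y : (promotion_stage T i y == None) =
    [&& vacated T y, T y <= i & i < min_next q T y].
  by rewrite stE andbA; case: (_ && _) => //=; case: leqP.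
have labelE y : (promotion_stage T i y == Some i.+1) = (T y == i.+1).
  rewrite stE; case: ifP => [/andP[_ le]|_]; last by [].
  have -> : (T y == i.+1) = false by apply/eqP; lia.
  by case: ifP => [le'|//]; apply/eqP => -[]; lia.
have actE y : active i.+1 (promotion_stage T i) y =
    [&& vacated T y, T y <= i & i < min_next q T y] || (T y == i.+1).
  by rewrite /active emptyE labelE.
(* An empty box, to be filled if its least following label has come up. *)
have [Ex|nEx] := boolP [&& vacated T x, T x <= i & i < min_next q T x].
  have /eqP ex : promotion_stage T i x == None by rewrite emptyE.
  have ax : active i.+1 (promotion_stage T i) x by rewrite actE Ex.
  rewrite ax card_component_gt1 // ex.
  case/and3P: Ex => vx lx mx.
  have -> : [exists y, adjacent x y && active i.+1 (promotion_stage T i) y] =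
            (min_next q T x <= i.+1).
    rewrite min_next_leq ltnS [q <= i]leqNgt; case/andP: (iq) => _ -> /=.
    apply: eq_existsb => y; rewrite /adjacent actE.
    case xy : (next_box x y) => /=.
      have := leq_trans mx (min_next_le q T xy) => lt.
      by rewrite [T y <= i]leqNgt lt /= andbF /=; apply/eqP/idP; lia.
    apply/andP => -[yx].
    have := min_next_le q T yx; have := Tnext yx.
    by move=> lt1 lt2 /orP[/and3P[_ _]|/eqP]; lia.
  rewrite ffunE vx (leqW lx) /=.
  have [le|] := leqP; last by [].
  by congr Some; lia.
(* A box labelled [i.+1], to be emptied if it is vacated. *)
have [eTx|neTx] := eqVneq (T x) i.+1.
  have /eqP ex : promotion_stage T i x == Some i.+1 by rewrite labelE eTx.
  have ax : active i.+1 (promotion_stage T i) x by rewrite actE eTx eqxx orbT.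
  rewrite ax card_component_gt1 // ex ffunE eTx leqnn andbT.
  have -> : [exists y, adjacent x y && active i.+1 (promotion_stage T i) y] =
            vacated T x.
    rewrite vacatedE eTx.
    have -> /= : (i.+1 == 1) = false by lia.
    apply: eq_existsb => y; rewrite /adjacent actE.
    case xy : (next_box x y) => /=.
      have := Tnext xy => lt.
      have -> : (T y <= i) = false by lia.
      have -> : (T y == i.+1) = false by lia.
      rewrite /= andbF /=; case yx : (next_box y x) => //=.
      by have := Tnext yx; lia.
    case yx : (next_box y x) => //=.
    have := Tnext yx; have := min_next_le q T yx => lt1 lt2.
    by case: (vacated T y) => /=; lia.
  case vx : (vacated T x) => //=.
  have := Tmin x; rewrite eTx => lt; case: leqP => //; lia.
have /negPf -> /= : ~~ active i.+1 (promotion_stage T i) x.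
  by rewrite actE negb_or nEx.
rewrite !ffunE; move: nEx; case vx : (vacated T x) => //=.
rewrite negb_and -leqNgt -ltnNge => /orP[gt|le].
  have -> : (T x <= i) = false by lia.
  by have -> : (T x <= i.+1) = false by lia.
rewrite le (leqW le).
have := Tmin x => lt.
have -> : (T x <= i) by lia.
by have -> : (T x <= i.+1) by lia.
Qed.

Lemma kpro_funE x :
  kpro_fun q T x = if vacated T x then (min_next q T x).-1 else (T x).-1.
Proof.
have q1 : 0 < q by have := Tq x; lia.
have -> : kpro_fun q T = fill_and_decrement q (promotion_stage T q).
  rewrite /kpro_fun; congr fill_and_decrement.
  rewrite -[in RHS](prednK q1); have : q.-1 < q by lia.
  elim: q.-1 => [_|n IHn ltn]; first exact: promotion_stage1.
  have -> : iota 2 n.+1 = iota 2 n ++ [:: n.+2].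
    by rewrite -(addn1 n) iotaD add2n addn1.
  by rewrite foldl_cat /= IHn ?swap_stage //; lia.
rewrite !ffunE; have /andP[_ ->] := Tq x; rewrite andbT.
case: (vacated T x) => //; case: leqP => //= gt.
suff -> : min_next q T x = q.+1 by [].
by apply/eqP; rewrite eqn_leq gt andbT min_next_leq ltnSn.
Qed.

(** A label cannot be lowered by one exactly when a vacated box before it takes
    that label, which is how a box becomes vacated. *)
Lemma kpro_fun_local x :
  kpro_fun q T x = local_rule q (kpro_fun q T) T T x.
Proof.
rewrite kpro_funE /local_rule; set free := (_ && _).
suff -> : free = ~~ vacated T x by case: (vacated T x).
rewrite vacatedE negb_or negb_exists {}/free.
have -> : (1 < T x) = (T x != 1) by have := Tq x; lia.
congr (_ && _); apply: eq_forallb => y.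
case yx : (next_box y x) => //=; rewrite kpro_funE.
have := Tnext yx; have := min_next_le q T yx; have := Tmin y; have := Tq y.
by case: (vacated T y) => /=; lia.
Qed.

End Increasing.
End Promotion.

(** * Rowmotion is injective on any finite poset *)

Section RowInjective.
Context {d : Order.disp_t} {P : finPOrderType d}.

Lemma minelts_below (A : {set P}) x :
  x \in A -> exists2 y, y \in minelts A & (y <= x)%O.
Proof. exact: (@maxelts_above _ P^d A x). Qed.

(** The complement of an ideal is generated upwards by its minimal elements; since
    these are the maximal elements of the image, rowmotion can be undone. *)
Lemma mem_ideal_minelts (I : {set P}) x : order_ideal I ->
  (x \in I) = ~~ [exists y in minelts (~: I), (y <= x)%O].
Proof.
move=> /order_idealP Iid; apply/idP/idP => [xI|].
  apply/exists_inP => -[y]; rewrite inE inE => /andP[/negP yI _] yx.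
  exact/yI/Iid/yx.
apply: contraNT => xI; apply/exists_inP; apply: minelts_below.
by rewrite inE.
Qed.

Lemma Row_inj : injective (@Row d P).
Proof.
move=> I J eIJ; apply: val_inj; apply/setP => x.
rewrite !mem_ideal_minelts; try exact: valP.
have maxE (K : ideals P) : minelts (~: val K) = maxelts (val (Row K)).
  by apply/esym/eqP; rewrite row_setP ?row_set_ideal.
by rewrite !maxE eIJ.
Qed.

End RowInjective.

(** * Rowmotion on a product of three chains obeys the local rule *)

Section Ideals.
Variables a b c : nat.
Hypotheses (a_gt0 : 0 < a) (b_gt0 : 0 < b).
Notation box := ('I_a * 'I_b)%type.
Notation P := ('I_a *p 'I_b *p 'I_c)%type.
Notation q := (a + b + c - 1).
Implicit Types (x y : box) (z w : 'I_c) (I J : {set P}).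

(* Forces the product order rather than a plain pair. *)
Let cell x z : P := (x, z).

Lemma cell_le x y z w :
  (cell x z <= cell y w)%O = [&& x.1 <= y.1, x.2 <= y.2 & z <= w].
Proof.
by case: x y => [i j] [i' j']; rewrite !Order.ProdOrder.leEprod /= -andbA.
Qed.

Lemma cell_lt x y z w :
  (cell x z < cell y w)%O =
  [&& x.1 <= y.1, x.2 <= y.2, z <= w & (x != y) || (z < w)].
Proof.
rewrite lt_neqAle cell_le xpair_eqE negb_and -val_eqE [z < w]ltn_neqAle.
by case: (_ <= _); case: (_ <= _); case: (_ <= _); case: (_ != _); case: (_ != _).
Qed.

Lemma next_cell_le x y z : next_box x y -> (cell x z <= cell y z)%O.
Proof.
by rewrite cell_le leqnn andbT => /orP[] /andP[/eqP -> /eqP]; lia.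
Qed.

Definition height I x : nat := \max_(z < c | cell x z \in I) z.+1.

Lemma height_le I x : height I x <= c.
Proof. by apply/bigmax_leqP => z _; apply: ltn_ord. Qed.

Lemma mem_height I x z : order_ideal I -> (cell x z \in I) = (z < height I x).
Proof.
move=> /order_idealP Iid; apply/idP/idP => [zI|].
  exact: (@leq_bigmax_cond _ (fun w => cell x w \in I) (fun w : 'I_c => w.+1)) zI.
apply: contraTT => zI; rewrite -leqNgt; apply/bigmax_leqP => w wI.
rewrite ltnNge; apply: contra zI => zw; apply: Iid wI _.
by rewrite cell_le !leqnn.
Qed.

Lemma height_anti I x y :
  order_ideal I -> next_box x y -> height I y <= height I x.
Proof.
move=> Iid xy; rewrite leqNgt; apply/negP => lt.
have ltc := leq_trans lt (height_le I y).
pose z := Ordinal ltc.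
have : cell x z \in I.
  apply: (elimT (order_idealP I) Iid) (next_cell_le z xy).
  by rewrite mem_height.
by rewrite mem_height //= ltnn.
Qed.

(** A minimal element of the complement above [cell y z] lies strictly above
    [cell x z], so minimality leaves no room for [cell x z] outside [I]. *)
Lemma row_below_mem I x y z : order_ideal I -> next_box x y ->
  cell y z \in row_set I -> cell x z \in I.
Proof.
move=> Iid xy; rewrite inE => /existsP[m /andP[mmin ym]].
apply: contraTT mmin => xI; rewrite inE negb_and; apply/orP; right.
apply/forall_inPn; exists (cell x z); first by rewrite inE.
rewrite negbK; apply: lt_le_trans ym; rewrite cell_lt.
have := next_cell_le z xy; rewrite cell_le => /and3P[-> -> ->] /=.
by rewrite (next_box_neq xy).
Qed.

Lemma height_row_le I x y : order_ideal I -> next_box x y ->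
  height (row_set I) y <= height I x.
Proof.
move=> Iid xy; rewrite leqNgt; apply/negP => lt.
pose z := Ordinal (leq_trans lt (height_le _ y)).
have := @row_below_mem I x y z Iid xy.
by rewrite !mem_height ?row_set_ideal //= => /(_ lt); rewrite ltnn.
Qed.

(** The top of the pile at [x] can be raised by one cell within the box and without
    breaking the ideal property; only then does the complement have a minimal
    element in the fibre over [x]. *)
Definition addable I x : bool :=
  (height I x < c) && [forall y, next_box y x ==> (height I x < height I y)].

Lemma height_mem_minelts I x z : order_ideal I ->
  (cell x z \in minelts (~: I)) = addable I x && (z == height I x :> nat).
Proof.
move=> Iid; apply/idP/andP.
  rewrite inE inE mem_height // -leqNgt => /andP[le /forall_inP zmin].
  have ez : z = height I x :> nat.
    apply/eqP; rewrite eqn_leq le andbT leqNgt; apply/negP => lt.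
    have lt' : height I x < c by apply: ltn_trans (ltn_ord z).
    have := zmin (cell x (Ordinal lt')).
    by rewrite inE mem_height //= ltnn cell_lt /= !leqnn lt (ltnW lt) orbT => /(_ isT).
  split; last exact/eqP.
  (* Otherwise the cell at the same height over [y] would be missing too. *)
  rewrite /addable -{1}ez ltn_ord; apply/forallP => y; apply/implyP => yx.
  rewrite ltnNge; apply/negP => le'.
  have := zmin (cell y z).
  rewrite inE mem_height // -leqNgt ez le' => /(_ isT) /negP; apply.
  rewrite cell_lt; have := next_cell_le z yx; rewrite cell_le => /and3P[-> -> ->] /=.
  by rewrite (next_box_neq yx).
case=> /andP[ltc /forallP add] /eqP ez.
rewrite inE inE mem_height // ez ltnn /=; apply/forall_inP => -[y w].
rewrite inE -/(cell y w) => yI; apply/negP; rewrite cell_lt => /and4P[le1 le2 lew].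
have [exy /= ltw|ne _] := eqVneq y x.
  by move: yI; rewrite exy mem_height // -ez ltw.
have [x' xx' /andP[le1' le2']] := next_box_back le1 le2 ne.
have := implyP (add x') xx'; apply/negP; rewrite -leqNgt.
rewrite ez in lew; apply: leq_trans lew; rewrite leqNgt; apply: contra yI => lt.
have x'I : cell x' w \in I by rewrite mem_height.
by apply: (elimT (order_idealP I) Iid) x'I _; rewrite cell_le le1' le2' /=.
Qed.

(** The lowest missing cell over [x] is minimal in the complement, and no minimal
    element can lie above a higher missing cell. *)
Lemma height_row_addable I x : order_ideal I -> addable I x ->
  height (row_set I) x = (height I x).+1.
Proof.
move=> Iid add; apply/eqP; rewrite eqn_leq; apply/andP; split.
  rewrite leqNgt; apply/negP => lt.
  pose z := Ordinal (leq_trans lt (height_le _ x)).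
  have : cell x z \in row_set I by rewrite mem_height ?row_set_ideal.
  rewrite inE => /existsP[m /andP[]]; rewrite inE => /andP[_ /forall_inP mmin] xm.
  have hc : height I x < c by case/andP: add.
  have := mmin (cell x (Ordinal hc)); rewrite inE mem_height //= ltnn => /(_ isT).
  move/negP; apply; apply: lt_le_trans xm.
  by rewrite cell_lt /= !leqnn leqnSn orbT.
have hc : height I x < c by case/andP: add.
have := @mem_height (row_set I) x (Ordinal hc) (row_set_ideal I) => /= <-.
rewrite inE; apply/existsP; exists (cell x (Ordinal hc)).
by rewrite lexx andbT height_mem_minelts // add /=.
Qed.

(** Without a minimal element over [x] itself, every element of the image over [x]
    is below a minimal element over a later box, hence comes from a successor. *)
Lemma height_row_stuck I x n : order_ideal I -> ~~ addable I x ->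
  (n < height (row_set I) x) =
  [exists y, next_box x y && (n < height (row_set I) y)].
Proof.
move=> Iid nadd; apply/idP/existsP => [lt|[y /andP[xy lt]]]; last first.
  by apply: leq_trans (height_anti (row_set_ideal I) xy).
pose z := Ordinal (leq_trans lt (height_le _ x)).
have : cell x z \in row_set I by rewrite mem_height ?row_set_ideal.
rewrite inE => /existsP[[x' z'] /andP[]]; rewrite -/(cell x' z') => mmin.
rewrite cell_le => /and3P[le1 le2 lez].
have ne : x != x'.
  apply: contraNneq nadd => ->.
  by move: mmin; rewrite height_mem_minelts // => /andP[].
have [y xy /andP[le1' le2']] := next_box_towards le1 le2 ne.
exists y; rewrite xy /=.
have := @mem_height (row_set I) y z (row_set_ideal I) => /= <-.
rewrite inE; apply/existsP; exists (cell x' z'); rewrite mmin cell_le le1' le2' /=.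
exact: lez.
Qed.

(** Heights weakly decrease along rows and columns; reversing them and adding the
    rank makes the entries strictly increase, starting at [1]. *)
Definition entry I x : nat := rank x + c.+1 - height I x.

Lemma rank_ub x : rank x <= a + b - 2.
Proof. by rewrite /rank; have := ltn_ord x.1; have := ltn_ord x.2; lia. Qed.

Lemma entry_bounds I x : 0 < entry I x <= q.
Proof. by rewrite /entry; have := height_le I x; have := rank_ub x; lia. Qed.

Lemma entry_next I x y : order_ideal I -> next_box x y -> entry I x < entry I y.
Proof.
move=> Iid xy; rewrite /entry (next_box_rank xy).
by have := height_anti Iid xy; have := height_le I x; lia.
Qed.

Lemma entry_row_next I x y : order_ideal I -> next_box x y ->
  entry I x < entry (row_set I) y.
Proof.
move=> Iid xy; rewrite /entry (next_box_rank xy).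
by have := height_row_le Iid xy; have := height_le I x; lia.
Qed.

Lemma addable_entry I x :
  addable I x = (1 < entry I x) &&
    [forall y, next_box y x ==> ((entry I y).+1 < entry I x)].
Proof.
have prevE : [forall y, next_box y x ==> (height I x < height I y)] =
             [forall y, next_box y x ==> ((entry I y).+1 < entry I x)].
  apply: eq_forallb => y; apply: implyb_id2l => /next_box_rank e.
  by rewrite /entry e; have := height_le I y; have := height_le I x; lia.
rewrite /addable prevE; case: (boolP [forall y, _]);
  rewrite ?andbF // !andbT => prev.
(* Off the first box, a predecessor is there to bound the height by [c]. *)
case: (posnP (rank x)) => [r0|r1].
  by rewrite /entry r0; have := height_le I x; lia.
have [y yx] : exists y, next_box y x.
  have ne : (Ordinal a_gt0, Ordinal b_gt0) != x.
    by apply: contraTneq r1 => <-.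
  have [|//|y yx _] := next_box_back _ _ ne; first by [].
  by exists y.
have := implyP (forallP prev y) yx; rewrite /entry (next_box_rank yx).
by have := height_le I y; have := height_le I x; lia.
Qed.

(** Raising the height means lowering the entry by one.  In the other case the
    greatest height over the successors corresponds to the least entry there, the
    default value of [min_next] accounting for height [0] over the last box. *)
Lemma entry_row_local I x : order_ideal I ->
  entry (row_set I) x = local_rule q (entry I) (entry I) (entry (row_set I)) x.
Proof.
move=> Iid; rewrite /local_rule -addable_entry; case: ifPn => [add|nadd].
  by rewrite /entry height_row_addable //; lia.
suff -> : min_next q (entry (row_set I)) x = (entry (row_set I) x).+1 by [].
apply/eqP; rewrite eqn_leq; apply/andP; split.
  rewrite min_next_leq.
  have [|nlast] := leqP q (entry (row_set I) x); first by rewrite ltnS => ->.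
  apply/orP; right.
  case: (posnP (height (row_set I) x)) => [h0|h1]; last first.
    have := height_row_stuck (height (row_set I) x).-1 Iid nadd.
    rewrite prednK // leqnn => /esym/existsP[y /andP[xy lt]].
    apply/existsP; exists y; rewrite xy /entry (next_box_rank xy) /=.
    by have := height_le (row_set I) x; lia.
  (* With height [0] and an entry below [q], the box is not the last one, so it
     has a successor, whose pile is empty as well. *)
  have a1 : a.-1 < a by lia.
  have b1 : b.-1 < b by lia.
  have ne : x != (Ordinal a1, Ordinal b1).
    by apply: contraTneq nlast => e; rewrite /entry h0 e /rank /=; lia.
  have [||y xy _] := next_box_towards _ _ ne.
  - by have := ltn_ord x.1; rewrite /=; lia.
  - by have := ltn_ord x.2; rewrite /=; lia.
  apply/existsP; exists y; rewrite xy /entry (next_box_rank xy) h0 /=.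
  by lia.
apply: min_next_gt => [|y xy]; first by case/andP: (entry_bounds (row_set I) x).
exact: entry_next (row_set_ideal I) xy.
Qed.

(** * Tableaux of ideals and their shear *)

(** Each step to the next box raises the label by at least one. *)
Lemma tableau_mono T x y : increasing_tableau q T ->
  x.1 <= y.1 -> x.2 <= y.2 -> T x + rank y <= T y + rank x.
Proof.
move=> /increasing_tableauP[_ Tnext].
have [n] := ubnP (rank y - rank x); elim: n x => // n IHn x lt le1 le2.
have [->//|ne] := eqVneq x y.
have [x' xx' /andP[le1' le2']] := next_box_towards le1 le2 ne.
have := IHn x' _ le1' le2'; have := Tnext _ _ xx'; have := next_box_rank xx'.
have : rank x' <= rank y by rewrite leq_add.
by move=> le e ltT; rewrite e => /(_ ltac:(lia)); lia.
Qed.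

Lemma tableau_bounds T x :
  increasing_tableau q T -> rank x < T x <= rank x + c.+1.
Proof.
move=> Tinc; have /increasing_tableauP[Tq _] := Tinc.
have a1 : a.-1 < a by lia.
have b1 : b.-1 < b by lia.
pose o : box := (Ordinal a_gt0, Ordinal b_gt0).
pose e : box := (Ordinal a1, Ordinal b1).
have := @tableau_mono T o x Tinc (leq0n _) (leq0n _).
have := @tableau_mono T x e Tinc _ _.
have le1 : x.1 <= a.-1 by have := ltn_ord x.1; lia.
have le2 : x.2 <= b.-1 by have := ltn_ord x.2; lia.
move=> /(_ le1 le2); have := Tq o; have := Tq e.
by rewrite /rank /=; lia.
Qed.

Lemma entry_increasing I :
  order_ideal I -> increasing_tableau q [ffun x => entry I x].
Proof.
move=> Iid; apply/increasing_tableauP; split=> [x|x y xy]; rewrite !ffunE.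
  exact: entry_bounds.
exact: entry_next.
Qed.

Definition tableau (I : ideals P) : Inc a b q :=
  exist _ [ffun x => entry (val I) x] (entry_increasing (valP I)).

Definition below_tableau (T : {ffun box -> nat}) : {set P} :=
  [set p : P | p.2 + T p.1 < rank p.1 + c.+1].

Lemma below_tableau_ideal T :
  increasing_tableau q T -> order_ideal (below_tableau T).
Proof.
move=> Tinc; apply/order_idealP => -[x z] [y w]; rewrite !inE /= => lt.
rewrite -[X in (X <= _)%O]/(cell y w) -[X in (_ <= X)%O]/(cell x z) cell_le.
by case/and3P=> le1 le2; have := tableau_mono Tinc le1 le2; lia.
Qed.

Lemma tableau_bij : bijective tableau.
Proof.
pose g (T : Inc a b q) : ideals P :=
  exist _ (below_tableau (val T)) (below_tableau_ideal (valP T)).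
exists g => [[I Iid]|[T Tinc]]; apply: val_inj => /=.
  apply/setP => -[x z]; rewrite inE /= ffunE /entry -[_ \in I]/(cell x z \in I).
  by rewrite mem_height //; have := height_le I x; lia.
apply/ffunP => x; rewrite ffunE /entry.
have /andP[T1 T2] := tableau_bounds x Tinc.
suff eh : height (below_tableau T) x = rank x + c.+1 - T x by rewrite eh subKn.
have memE z : (z < height (below_tableau T) x) = (z + T x < rank x + c.+1).
  by rewrite -mem_height ?below_tableau_ideal // inE.
have := height_le (below_tableau T) x => hc.
apply/eqP; rewrite eqn_leq; apply/andP; split.
  rewrite leqNgt; apply/negP => lt.
  by have := memE (Ordinal (leq_trans lt hc)); rewrite /=; lia.
rewrite leqNgt; apply/negP => lt.
have hc' : height (below_tableau T) x < c by lia.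
by have := memE (Ordinal hc'); rewrite /=; lia.
Qed.

(** Each step of rank is delayed by one application of rowmotion: this is the
    change of time slice that turns the sweep from large to small ranks into the
    sweep from small to large ranks. *)
Definition sheared (I : ideals P) : {ffun box -> nat} :=
  [ffun x => entry (val (iter (rank x) Row I)) x].

Lemma sheared_increasing (I : ideals P) : increasing_tableau q (sheared I).
Proof.
apply/increasing_tableauP; split=> [x|x y xy]; rewrite !ffunE.
  exact: entry_bounds.
rewrite (next_box_rank xy) iterS; apply: entry_row_next => //.
exact: valP.
Qed.

Definition sheared_tableau (I : ideals P) : Inc a b q :=
  exist _ (sheared I) (sheared_increasing I).

(** Over a predecessor [y] of [x], the shear of [Row I] is read off at the time at
    which the shear of [I] is read off over [x]; over a successor, the shear of [I]
    is read off one step later.  So the rule for rowmotion at [x] becomes the rule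
    for K-promotion at [x]. *)
Lemma sheared_tableau_Row (I : ideals P) :
  sheared_tableau (Row I) = KPro (sheared_tableau I).
Proof.
apply: val_inj => /=; apply/ffunP.
apply: (@local_rule_unique _ _ q (sheared I)) => x; last first.
  exact: kpro_fun_local (sheared_increasing I) x.
rewrite {1}/sheared ffunE -iterSr iterS entry_row_local; last exact: valP.
apply: eq_local_rule => [y yx||y xy]; rewrite ffunE //.
- by rewrite -iterSr (next_box_rank yx).
- by rewrite (next_box_rank xy).
Qed.

(** The shear determines the tableaux of all its images under K-promotion, hence,
    over every box, all sufficiently late values of the orbit; the whole ideal at
    time [a + b] is known, and rowmotion is injective. *)
Lemma sheared_tableau_inj : injective sheared_tableau.
Proof.
move=> I J eIJ.
have eN n : sheared_tableau (iter n Row I) = sheared_tableau (iter n Row J).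
  by elim: n => //= n IHn; rewrite !sheared_tableau_Row IHn.
have /(bij_inj tableau_bij) :
    tableau (iter (a + b) Row I) = tableau (iter (a + b) Row J).
  apply: val_inj; apply/ffunP => x; rewrite !ffunE.
  have lex : rank x <= a + b by have := rank_ub x; lia.
  have /(congr1 val) /= /ffunP /(_ x) := eN (a + b - rank x).
  by rewrite !ffunE -!iterD subnKC.
by elim: (a + b) => //= n IHn /Row_inj.
Qed.

(** The unsheared map identifies the tableaux with the finite type of ideals, where
    injectivity is enough. *)
Lemma sheared_tableau_bij : bijective sheared_tableau.
Proof.
have [g tabK gK] := tableau_bij.
have ginj : injective g := can_inj gK.
have /injF_bij bij :
    injective (g \o sheared_tableau : {I : {set P} | order_ideal I} -> _).
  exact: inj_comp ginj sheared_tableau_inj.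
apply: (eq_bij (bij_comp tableau_bij bij)) => I /=.
exact: gK.
Qed.

End Ideals.

Theorem theorem4p5 (a b c : nat) (ha : 1 <= a) (hb : 1 <= b) (hc : 1 <= c) :
  exists phi : ideals ('I_a *p 'I_b *p 'I_c)%type -> Inc a b (a + b + c - 1),
    bijective phi /\
    forall I : ideals ('I_a *p 'I_b *p 'I_c)%type,
      phi (Row I) = KPro (phi I).
Proof.
exists (@sheared_tableau a b c ha hb); split; first exact: sheared_tableau_bij.
exact: sheared_tableau_Row.
Qed.
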